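(* Suppose that for every matroid $M$ and every circuit system $\mathcal{C}=\{C_1,\dots,C_g\}$ on $M$ whose total unique union $\mathcal{C}_{[g]}$ is a circuit of $M$, the set $\mathcal{C}_{\ge 3}$ is independent in $M$. Then for every matroid $M$, every circuit system $\mathcal{C}=\{C_1,\dots,C_g\}$ on $M$, and every circuit $D$ of $M$, we have $|\mathcal{S}_D|=1$; that is, there is a unique $S\subseteq[g]$ with $\mathcal{C}_S=D$.
   Context: Matroids are on finite ground sets; $E(M)$ is the ground set and $r(M)$ the rank. A set is dependent if it is not independent. A cycle of $M$ is a subset of $E(M)$ that can be expressed as a union of circuits. The corank of $M$ is $g=|E(M)|-r(M)$. For subsets $A_1,\dots,A_k$ of a set $E$ and $S\subseteq[k]=\{1,\dots,k\}$, the unique union $\mathcal{A}_S=\ast\{A_i: i\in S\}$ is the set of elements of $E$ that belong to exactly one of the sets $A_i$, $i\in S$. A cycle system on a matroid $M$ of corank $g$ is a collection $\mathcal{C}=\{C_1,\dots,C_g\}$ of $g$ cycles of $M$ such that for every nonempty $S\subseteq[g]$ the unique union $\mathcal{C}_S=\ast\{C_i:i\in S\}$ is dependent in $M$. A circuit system is a cycle system all of whose elements are circuits. For a cycle system $\mathcal{C}$ on $M$, $\mathcal{C}_{\ge 3}$ denotes the set of elements of $E(M)$ that belong to at least $3$ of the cycles in $\mathcal{C}$. For a circuit $D$ of $M$, $\mathcal{S}_D=\{S\subseteq[g]:\mathcal{C}_S=D\}$. *)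

(* Defs.v *)
From mathcomp Require Import all_boot.

Set Implicit Arguments.
Unset Strict Implicit.
Unset Printing Implicit Defensive.

(* The ground set is a subset of a finite type rather than the whole type, so
   that matroids obtained by deletion or contraction live over the same type. *)
Record matroid (T : finType) := Matroid {
  ground : {set T};
  indep : pred {set T};
  indep_ground : forall A : {set T}, indep A -> A \subset ground;
  indep0 : indep set0;
  indepS : forall A B : {set T}, A \subset B -> indep B -> indep A;
  indep_aug : forall A B : {set T}, indep A -> indep B -> #|A| < #|B| ->
    exists2 x, x \in B :\: A & indep (x |: A)
}.

Definition rank (T : finType) (M : matroid T) : nat :=
  \max_(A : {set T} | indep M A) #|A|.

Definition corank (T : finType) (M : matroid T) : nat :=
  #|ground M| - rank M.

Definition dependent (T : finType) (M : matroid T) (A : {set T}) : bool :=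
  (A \subset ground M) && ~~ indep M A.

Definition circuit (T : finType) (M : matroid T) (A : {set T}) : bool :=
  minset (dependent M) A.

(* The union may be empty: set0 is a cycle. *)
Definition is_cycle (T : finType) (M : matroid T) (A : {set T}) : bool :=
  [exists P : {set {set T}}, [forall D in P, circuit M D] && (A == cover P)].

Definition unique_union (T I : finType) (A : I -> {set T}) (S : {set I}) :
    {set T} :=
  [set x | #|[set i in S | x \in A i]| == 1].

(* A collection of g cycles is an indexed family; its members are
   automatically pairwise distinct, since C i = C j with i != j would make the
   unique union over [set i; j] empty, hence independent. *)
Definition cycle_system (T : finType) (M : matroid T)
    (C : 'I_(corank M) -> {set T}) : Prop :=
  (forall i, is_cycle M (C i)) /\
  (forall S : {set 'I_(corank M)}, S != set0 -> dependent M (unique_union C S)).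

Definition circuit_system (T : finType) (M : matroid T)
    (C : 'I_(corank M) -> {set T}) : Prop :=
  cycle_system C /\ forall i, circuit M (C i).

Definition in_at_least3 (T : finType) (M : matroid T)
    (C : 'I_(corank M) -> {set T}) : {set T} :=
  [set x in ground M | 3 <= #|[set i | x \in C i]|].

Definition subsets_yielding (T : finType) (M : matroid T)
    (C : 'I_(corank M) -> {set T}) (D : {set T}) : {set {set 'I_(corank M)}} :=
  [set S | unique_union C S == D].

(* Main.v *)
Require Import Defs.
From mathcomp Require Import all_boot.

(** Both existence and uniqueness of [S] follow from one induction on the
    corank, in which a system is shrunk by deleting an element.

    Suppose some element [e] outside the circuit [D] lies in the total unique
    union, so that it belongs to exactly one member [C i].  Any [S] containing
    [i] has [e] in its unique union, hence cannot yield [D]; so only the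
    subsets avoiding [i] matter.  Since [e] lies on a circuit, deleting it
    lowers the corank by one, and the members other than [C i], which all avoid
    [e], form a circuit system on the deletion.  The deletion has the same
    circuit [D] and the same sets yielding it ([unique_yielding]).

    Otherwise the total unique union is contained in [D], and being dependent
    it equals [D]: the full index set yields [D].  Suppose a proper subset [S]
    yields [D] as well, and let [x] lie in exactly one member indexed by the
    complement of [S].  If [x] were in exactly one member indexed by [S], it
    would be in [D] but in two members altogether; if it were in none, it would
    be in the total unique union [D] but not in the unique union over [S].
    So [x] lies in at least three members
    ([unique_union_compl_sub_ge3]).  The unique union over the complement is
    thus a dependent subset of the set of elements covered at least three times,
    which the hypothesis says is independent. *)

Set Implicit Arguments.
Unset Strict Implicit.
Unset Printing Implicit Defensive.

(** * Rank, corank and deletion in a matroid *)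

Section Matroid.
Variables (T : finType) (M : matroid T).
Implicit Types (A B D : {set T}) (e : T).

Lemma circuit_dependent D : circuit M D -> dependent M D.
Proof. by case/minsetP. Qed.

Lemma circuitD1_indep D e : circuit M D -> e \in D -> indep M (D :\ e).
Proof.
move=> /minsetP[/andP[sDE _] minD] De; apply/negPn/negP=> nDe.
have /minD : dependent M (D :\ e).
  by rewrite /dependent nDe (subset_trans (subD1set D e) sDE).
by move/(_ (subD1set D e))/setP/(_ e); rewrite !inE eqxx De.
Qed.

Lemma circuit_is_cycle D : circuit M D -> is_cycle M D.
Proof.
move=> cD; apply/existsP; exists [set D]; apply/andP; split; last first.
  by rewrite /cover big_set1.
by apply/forallP=> A; apply/implyP=> /set1P->.
Qed.

Lemma indep_leq_rank A : indep M A -> #|A| <= rank M.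
Proof. by move=> iA; apply: (bigmax_sup A). Qed.

Lemma rank_attained : exists2 B, indep M B & #|B| = rank M.
Proof.
have [|B iB eqB] := @eq_bigmax_cond _ (indep M) (fun A : {set T} => #|A|).
  by apply/card_gt0P; exists set0; apply: indep0.
by exists B => //; rewrite /rank eqB.
Qed.

Lemma extend_to_rank A :
  indep M A -> exists B, [/\ A \subset B, indep M B & #|B| = rank M].
Proof.
have [n] := ubnP (rank M - #|A|); elim: n A => // n IHn A ltn iA.
have [B iB cardB] := rank_attained.
have [ltAB | geAB] := ltnP #|A| #|B|; last first.
  exists A; split=> //; apply/eqP; rewrite eqn_leq indep_leq_rank //=.
  by rewrite -cardB.
have [x /setDP[_ nAx] iAx] := indep_aug iA iB ltAB.
have [|B' [sAB' iB' cardB']] := IHn (x |: A) _ iAx.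
  rewrite cardsU1 nAx add1n; apply: leq_trans (_ : rank M - #|A| <= n) => //.
  by rewrite subnS prednK // subn_gt0 -cardB.
by exists B'; split=> //; apply: subset_trans sAB'; apply: subsetUr.
Qed.

Lemma circuit_corank_gt0 D : circuit M D -> 0 < corank M.
Proof.
move/circuit_dependent/andP=> [sDE nD].
have [B iB cardB] := rank_attained.
have sBE := indep_ground iB.
rewrite subn_gt0 -cardB; apply: proper_card; rewrite properE sBE /=.
by apply: contra nD => /(subset_trans sDE) sDB; apply: indepS iB.
Qed.

Section Deletion.
Variable e : T.

Definition del_indep : pred {set T} :=
  [pred A : {set T} | (A \subset ground M :\ e) && indep M A].

Fact del_indep_ground A : del_indep A -> A \subset ground M :\ e.
Proof. by case/andP. Qed.

Fact del_indep0 : del_indep set0.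
Proof. by rewrite /del_indep inE sub0set indep0. Qed.

Fact del_indepS A B : A \subset B -> del_indep B -> del_indep A.
Proof.
move=> sAB /andP[sBE iB]; apply/andP; split; first exact: subset_trans sBE.
exact: indepS iB.
Qed.

Fact del_indep_aug A B : del_indep A -> del_indep B -> #|A| < #|B| ->
  exists2 x, x \in B :\: A & del_indep (x |: A).
Proof.
move=> /andP[sAE iA] /andP[sBE iB] ltAB.
have [x xBA iAx] := indep_aug iA iB ltAB; exists x => //.
rewrite /del_indep inE iAx andbT subUset sub1set sAE andbT.
by apply: (subsetP sBE); case/setDP: xBA.
Qed.

Definition deletion : matroid T :=
  Matroid del_indep_ground del_indep0 del_indepS del_indep_aug.

Lemma dependent_deletion A :
  dependent deletion A = (e \notin A) && dependent M A.
Proof.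
rewrite /dependent /= /del_indep inE subsetD1.
by case: (A \subset ground M); case: (e \in A).
Qed.

Lemma circuit_deletion D : e \notin D -> circuit M D -> circuit deletion D.
Proof.
move=> nDe /minsetP[dD minD]; apply/minsetP; split.
  by rewrite dependent_deletion nDe.
by move=> A; rewrite dependent_deletion => /andP[_]; apply: minD.
Qed.

(** An independent set of full rank that contains [D :\ e] cannot contain [e],
    so it survives the deletion. *)
Lemma rank_deletion D : circuit M D -> e \in D -> rank deletion = rank M.
Proof.
move=> cD De; apply/eqP; rewrite eqn_leq; apply/andP; split.
  by apply/bigmax_leqP=> A /andP[_ iA]; apply: indep_leq_rank.
have [B [sDB iB <-]] := extend_to_rank (circuitD1_indep cD De).
apply: (bigmax_sup B) => //; apply/andP; split=> //.
rewrite subsetD1 (indep_ground iB) /=; apply/negP=> Be.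
have /andP[_ /negP[]] := circuit_dependent cD.
by apply: indepS iB; rewrite -(setD1K De) subUset sub1set Be.
Qed.

Lemma corank_deletion D :
  circuit M D -> e \in D -> corank deletion = (corank M).-1.
Proof.
move=> cD De; rewrite /corank (rank_deletion cD De) /=.
have /andP[/subsetP/(_ e De) Ee _] := circuit_dependent cD.
by rewrite (cardsD1 e (ground M)) Ee add1n -subnS subSS.
Qed.

End Deletion.
End Matroid.

(** * Unique unions *)

Lemma mem_unique_union (T I : finType) (C : I -> {set T}) (S : {set I}) x :
  (x \in unique_union C S) = (#|[set i in S | x \in C i]| == 1).
Proof. by rewrite inE. Qed.

Section UniqueUnion.
Variables (T I : finType) (C : I -> {set T}).
Implicit Types (J S : {set I}).

Lemma unique_union_imset (I' : finType) (f : I' -> I) (S : {set I'}) :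
  injective f -> unique_union (C \o f) S = unique_union C (f @: S).
Proof.
move=> injf; apply/setP=> x; rewrite !mem_unique_union; congr (_ == _).
rewrite -(card_imset _ injf); apply: eq_card=> i.
rewrite inE; apply/imsetP/andP=> [[j] | [/imsetP[j Sj ->] xCj]].
  by rewrite inE => /andP[Sj xCj] ->; rewrite imset_f.
by exists j; rewrite // inE Sj.
Qed.

(** The members covering [x] over [J] split into those over [S] and those over
    its complement; equality of the two unique unions excludes every count
    below three when the complement contributes exactly one. *)
Lemma unique_union_compl_sub_ge3 J S x :
    S \subset J -> unique_union C S = unique_union C J ->
  x \in unique_union C (J :\: S) -> 3 <= #|[set i in J | x \in C i]|.
Proof.
move=> sSJ eqSJ; have := erefl (x \in unique_union C S).
rewrite {2}eqSJ !mem_unique_union => eq1 /eqP one.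
have splitJ : #|[set i in J | x \in C i]| =
    #|[set i in S | x \in C i]| + #|[set i in J :\: S | x \in C i]|.
  rewrite -(cardsID S); congr (_ + _); apply: eq_card=> i; rewrite !inE.
    case Si: (i \in S); last by rewrite andbF.
    by rewrite (subsetP sSJ i Si) andbT.
  by rewrite andbA.
move: eq1; rewrite splitJ one addn1 eqSS.
by case: #|[set i in S | x \in C i]| => [|[|n]].
Qed.

End UniqueUnion.

(** * Circuit systems under deletion and reindexing *)

(** Indexing by a subset [J] of a fixed type, rather than by ordinals below the
    corank, lets a deletion keep the family and merely drop an index. *)
Definition indexed_circuit_system (T I : finType) (M : matroid T)
    (C : I -> {set T}) (J : {set I}) : Prop :=
  [/\ #|J| = corank M, {in J, forall i, circuit M (C i)} &
      forall S : {set I}, S \subset J -> S != set0 ->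
        dependent M (unique_union C S)].

Lemma indexed_system_deletion (T I : finType) (M : matroid T)
    (C : I -> {set T}) (J : {set I}) (e : T) (i : I) :
    indexed_circuit_system M C J -> [set j in J | e \in C j] = [set i] ->
  indexed_circuit_system (deletion M e) C (J :\ i).
Proof.
move=> [cardJ circC depC] eqi.
have /setIdP[Ji Cie] : i \in [set j in J | e \in C j].
  by rewrite eqi set11.
have avoid j : j \in J :\ i -> e \notin C j.
  case/setD1P=> ne Jj; apply: contra ne => Cje.
  by rewrite -in_set1 -eqi inE Jj.
split.
- by rewrite (corank_deletion (circC i Ji) Cie) -cardJ (cardsD1 i J) Ji.
- move=> j Jij; apply: circuit_deletion; first exact: avoid.
  by apply: circC; case/setD1P: Jij.
- move=> S sSJ S0; rewrite dependent_deletion depC // ?andbT; last first.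
    exact: subset_trans sSJ (subD1set J i).
  rewrite mem_unique_union (_ : [set _ in S | _] = set0) ?cards0 //.
  apply/setP=> j; rewrite !inE; apply/negP=> /andP[Sj Cje].
  by have /negP[] := avoid j (subsetP sSJ j Sj).
Qed.

Definition ge3_indep_property : Prop :=
  forall (T : finType) (M : matroid T) (C : 'I_(corank M) -> {set T}),
    circuit_system C ->
    circuit M (unique_union C [set: 'I_(corank M)]) ->
    indep M (in_at_least3 C).

Lemma ge3_indep_indexed (T I : finType) (M : matroid T)
    (C : I -> {set T}) (J : {set I}) :
    ge3_indep_property -> indexed_circuit_system M C J ->
    circuit M (unique_union C J) ->
  indep M [set x in ground M | 3 <= #|[set i in J | x \in C i]|].
Proof.
move=> ge3 [cardJ circC depC] circJ.
pose f (k : 'I_(corank M)) := enum_val (cast_ord (esym cardJ) k).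
have injf : injective f by move=> k l /enum_val_inj/cast_ord_inj.
have fJ k : f k \in J by apply: enum_valP.
have imf : f @: [set: 'I_(corank M)] = J.
  apply/eqP; rewrite eqEcard card_imset // cardsT card_ord cardJ leqnn andbT.
  by apply/subsetP=> _ /imsetP[k _ ->].
have sysf : circuit_system (C \o f).
  have circf k : circuit M ((C \o f) k) by apply: circC.
  split=> //; split=> [k | S S0]; first exact: circuit_is_cycle.
  rewrite unique_union_imset //; apply: depC; last by rewrite imset_eq0.
  by apply/subsetP=> _ /imsetP[k _ ->].
have /(ge3 _ _ _ sysf) : circuit M (unique_union (C \o f) setT).
  by rewrite unique_union_imset // imf.
congr (indep M _); apply/setP=> x; rewrite !inE; congr (_ && (3 <= _)).
rewrite -(card_imset _ injf); apply: eq_card=> i.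
rewrite inE -imf; apply/imsetP/andP=> [[k] | [/imsetP[k _ ->] xCk]].
  by rewrite inE => xCk ->; rewrite imset_f.
by exists k; rewrite // inE.
Qed.

(** * The unique subset yielding a circuit *)

Lemma unique_yielding (T I : finType) (M : matroid T)
    (C : I -> {set T}) (J : {set I}) (D : {set T}) :
    ge3_indep_property -> indexed_circuit_system M C J -> circuit M D ->
  #|[set S : {set I} | (S \subset J) && (unique_union C S == D)]| = 1.
Proof.
move=> ge3; have [n] := ubnP #|J|; elim: n => // n IHn in M J *.
move=> ltJn sysJ circD; have [cardJ circC depC] := sysJ.
have [sUD | /subsetPn[e]] := boolP (unique_union C J \subset D); last first.
  rewrite mem_unique_union => /cards1P[i eqi] nDe.
  have /setIdP[Ji Cie] : i \in [set j in J | e \in C j].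
    by rewrite eqi set11.
  rewrite -[RHS](IHn (deletion M e) (J :\ i)); first last.
  - exact: circuit_deletion.
  - exact: indexed_system_deletion.
  - by move: ltJn; rewrite (cardsD1 i J) Ji.
  apply: eq_card=> S; rewrite !inE subsetD1.
  case: (boolP (S \subset J)) => //= sSJ.
  case Si: (i \in S) => //=; apply: contraNF nDe => /eqP <-.
  rewrite mem_unique_union; apply/cards1P; exists i; apply/setP=> j.
  rewrite -eqi !inE; case Sj: (j \in S) => /=.
    by rewrite (subsetP sSJ j Sj).
  apply/esym/negP=> /andP[Jj Cje]; have : j \in [set i] by rewrite -eqi inE Jj.
  by rewrite inE => /eqP eji; rewrite eji Si in Sj.
have J0 : J != set0 by rewrite -card_gt0 cardJ (circuit_corank_gt0 circD).
have UJ : unique_union C J = D.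
  by case/minsetP: circD => _; apply=> //; apply: depC.
rewrite -(cards1 J); apply: eq_card=> S; rewrite !inE.
apply/andP/eqP=> [[sSJ /eqP US] | ->]; last by rewrite UJ eqxx subxx.
apply/eqP; rewrite eqEsubset sSJ -setD_eq0 /=; apply/negPn/negP=> JS0.
have dJS := depC _ (subsetDl J S) JS0; have /andP[sE /negP[]] := dJS.
rewrite -UJ in circD US.
apply: indepS (ge3_indep_indexed ge3 sysJ circD).
apply/subsetP=> x Ux; rewrite inE (subsetP sE x Ux).
exact: unique_union_compl_sub_ge3 Ux.
Qed.

Theorem theorem6p9 :
  (forall (T : finType) (M : matroid T) (C : 'I_(corank M) -> {set T}),
     circuit_system C ->
     circuit M (unique_union C [set: 'I_(corank M)]) ->
     indep M (in_at_least3 C)) ->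
  forall (T : finType) (M : matroid T) (C : 'I_(corank M) -> {set T}),
    circuit_system C ->
    forall D : {set T}, circuit M D -> #|subsets_yielding C D| = 1.
Proof.
move=> ge3 T M C [[_ depC] circC] D circD.
have sysC : indexed_circuit_system M C setT.
  by split=> [|i _|S _]; [rewrite cardsT card_ord | exact: circC | exact: depC].
rewrite -[RHS](unique_yielding ge3 sysC circD).
by apply: eq_card=> S; rewrite !inE subsetT.
Qed.
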